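(* Let $I\subset[0,+\infty)$ be an open interval, $n\in\mathbb{N}$, $\beta\in\{-1,1\}$, $\kappa,\mu\in\,]-1,+\infty[$, $N\ge n$, $\xi\in[0,1]$, $t_0\in I$, $T>0$ with $t_0+\beta T\in I$. If the noise $\{\varpi(\tau),\tau\ge0\}$ satisfies conditions (C1), (C2) and (C3), then the noise error contribution of the Jacobi estimator $\hat D^{\mu,\kappa}_{\beta T,N,\xi}x^{(n)}(t_0)$ satisfies $e_{\varpi}^{\beta T}(t_0)=0$ almost surely.
   Context: For $a,b>-1$ let $w^{a,b}(t)=t^{b}(1-t)^{a}$, $P_k^{a,b}(t)=\sum_{s=0}^{k}\binom{k+a}{s}\binom{k+b}{k-s}(t-1)^{k-s}t^{s}$ and $\|P_k^{a,b}\|^2=\int_0^1 w^{a,b}(P_k^{a,b})^2$. With $q=N-n$ the Jacobi estimator kernel is $$p^{\beta T}(\tau)=\frac{(-1)^n}{(\beta T)^n}\sum_{i=0}^{q}\frac{P_i^{\mu+n,\kappa+n}(\xi)}{\|P_i^{\mu+n,\kappa+n}\|^2}\frac{d^n}{d\tau^n}\Big[w^{\mu+n,\kappa+n}(\tau)P_i^{\mu+n,\kappa+n}(\tau)\Big],$$ and the noise error contribution is the mean-square integral $e_{\varpi}^{\beta T}(t_0)=\int_0^1 p^{\beta T}(\tau)\varpi(t_0+\beta T\tau)d\tau$. (C1): $\{\varpi(\tau),\tau\ge0\}$ is a continuous parameter stochastic process with finite second moments whose mean value function and covariance kernel are continuous. (C2): for all $t_0$, $s$, $\tau$ with $t_0+s,t_0+\tau\in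 I$, $E[\varpi(t_0+\tau)]=\sum_{i=0}^{n-1}\nu_i t_0^{k_1(i)}\tau^i+E[\varpi(\tau)]$ and $\mathrm{Cov}[\varpi(t_0+s),\varpi(t_0+\tau)]=\Big(\sum_{i=0}^{n_1}\eta_i t_0^{k_2(i)}\tau^i\Big)\Big(\sum_{i=0}^{n_2}\eta'_i t_0^{k_3(i)}s^i\Big)+\mathrm{Cov}[\varpi(s),\varpi(\tau)]$, where $k_1(i),k_2(i),k_3(i)\in\mathbb{N}$, $\nu_i,\eta_i,\eta'_i\in\mathbb{R}$, $n_1,n_2\in\mathbb{N}$ with $\min(n_1,n_2)\le n-1$. (C3): for all $s,\tau\in I$, $E[\varpi(\tau)]=\sum_{i=0}^{n-1}\bar\nu_i\tau^i$ and $\mathrm{Cov}[\varpi(s),\varpi(\tau)]=\Big(\sum_{i=0}^{n_1}\bar\eta_i\tau^i\Big)\Big(\sum_{i=0}^{n_2}\bar\eta'_i s^i\Big)$ with $\bar\nu_i,\bar\eta_i,\bar\eta'_i\in\mathbb{R}$ and $\min(n_1,n_2)\le n-1$. *)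

(* Defs.v *)
From HB Require Import structures.
From mathcomp Require Import all_boot all_order all_algebra.
From mathcomp Require Import all_classical all_reals all_analysis.
Set Implicit Arguments. Unset Strict Implicit. Unset Printing Implicit Defensive.
Import Order.TTheory GRing.Theory Num.Theory.
Import numFieldNormedType.Exports.
Local Open Scope classical_set_scope.
Local Open Scope ring_scope.

Section jacobi.
Variable R : realType.

Definition genbinom (x : R) (s : nat) : R :=
  (\prod_(i < s) (x - i%:R)) / (s`!)%:R.

Definition jacw (a b t : R) : R := t `^ b * (1 - t) `^ a.

Definition jacobiP (a b : R) (k : nat) (t : R) : R :=
  \sum_(s < k.+1) genbinom (k%:R + a) s * genbinom (k%:R + b) (k - s)
                  * (t - 1) ^+ (k - s) * t ^+ s.

Definition jacnorm2 (a b : R) (k : nat) : R :=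
  Rintegral (@lebesgue_measure R) `[0, 1]
    (fun t => jacw a b t * (jacobiP a b k t) ^+ 2).

Definition jacobi_kernel (n N : nat) (mu kappa xi beta T : R) (tau : R) : R :=
  (-1) ^+ n / (beta * T) ^+ n *
  \sum_(i < (N - n).+1)
     (jacobiP (mu + n%:R) (kappa + n%:R) i xi / jacnorm2 (mu + n%:R) (kappa + n%:R) i
      * derive1n n (fun t => jacw (mu + n%:R) (kappa + n%:R) t
                              * jacobiP (mu + n%:R) (kappa + n%:R) i t) tau).

End jacobi.

Section mean_square.
Context d (Omega : measurableType d) (R : realType) (P : probability Omega R).

Definition tagged_partition (a b : R) (m : nat) (x y : nat -> R) : Prop :=
  x 0%N = a /\ x m = b /\ (forall i, (i < m)%N -> x i <= y i <= x i.+1).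

Definition mesh_lt (m : nat) (x : nat -> R) (delta : R) : Prop :=
  forall i, (i < m)%N -> x i.+1 - x i < delta.

Definition riemann_sum (g : R -> R) (X : R -> Omega -> R) (m : nat)
    (x y : nat -> R) : Omega -> R :=
  fun w => \sum_(i < m) g (y i) * X (y i) w * (x i.+1 - x i).

Definition ms_integral (g : R -> R) (X : R -> Omega -> R) (a b : R)
    (e : Omega -> R) : Prop :=
  forall eps : R, 0 < eps -> exists2 delta : R, 0 < delta &
    forall m x y, tagged_partition a b m x y -> mesh_lt m x delta ->
      (\int[P]_w ((riemann_sum g X m x y w - e w) ^+ 2)%:E < eps%:E)%E.

(* mean-square integral over [0,1], understood (because the kernel may be
   singular at the endpoints) as the (improper) mean-square limit of the
   mean-square integrals over [a,b] as a -> 0+, b -> 1- *)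
Definition ms_integral01 (g : R -> R) (X : R -> Omega -> R) (e : Omega -> R) : Prop :=
  (forall a b, 0 < a -> a < b -> b < 1 -> exists eab, ms_integral g X a b eab) /\
  (forall eps : R, 0 < eps -> exists2 delta : R, 0 < delta &
     forall a b eab, 0 < a -> a < delta -> 1 - delta < b -> b < 1 -> a < b ->
       ms_integral g X a b eab ->
       (\int[P]_w ((eab w - e w) ^+ 2)%:E < eps%:E)%E).

End mean_square.

(* Main.v *)
Require Import Defs.
From HB Require Import structures.
From mathcomp Require Import all_boot all_order all_algebra.
From mathcomp Require Import all_classical all_reals all_analysis.
From mathcomp Require Import measurable_realfun.
From mathcomp Require Import ring lra.
Import Order.TTheory GRing.Theory Num.Theory.
Import numFieldNormedType.Exports.
Local Open Scope classical_set_scope.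
Local Open Scope ring_scope.

(* By (C3) the centred process has a covariance of rank one on I, so that
   varpi(t) = m(t) + phi(t) Z almost surely, for one square-integrable random
   variable Z and polynomials m, phi of degree < n; here phi is whichever of
   the two factors of the covariance has degree < n, the symmetry of the
   covariance making them proportional.  Integrating by parts n times, the
   kernel times a polynomial of degree < n has a primitive on ]0, 1[ that
   vanishes at both endpoints, because the derivatives of order < n of
   w^{mu+n,kappa+n} P_i do.  Hence the mean-square integral over [a, b]
   is c(a,b) + c'(a,b) Z where c(a,b) and c'(a,b) tend to 0 as a -> 0 and
   b -> 1. *)

Set Implicit Arguments.
Unset Strict Implicit.
Unset Printing Implicit Defensive.

(** * Derivatives of the Jacobi weight times a polynomial *)

Lemma is_derive_powR (R : realType) (a x : R) : 0 < x ->
  is_derive x 1 (fun t => t `^ a) (a * x `^ (a - 1)).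
Proof.
move=> x0; have xI : x \in `]0, +oo[ by rewrite in_itv/= x0.
apply: DeriveDef; first exact: derivable_powR.
by rewrite -derive1E powR_derive1.
Qed.

Lemma is_derive_horner (R : realType) (p : {poly R}) (x : R) :
  is_derive x 1 (horner p) (p^`()).[x].
Proof.
apply: DeriveDef; first exact: derivable_horner.
by rewrite -derive1E -derivE.
Qed.

(** Splitting off one factor [x] and one factor [1 - x] from the weight, by [z^c = z * z^(c-1)] for
    positive [z], brings the three terms of the product rule over a common weight. The derivative is
    thus again a weight times a polynomial, which makes the formula iterable. *)
Lemma is_derive_jacw_horner (R : realType) (a b x : R) (p : {poly R}) :
  0 < x < 1 ->
  is_derive x 1 (fun t => jacw a b t * p.[t])
    (jacw (a - 1) (b - 1) x *
     (b *: ((1 - 'X) * p) - a *: ('X * p) + 'X * (1 - 'X) * p^`()).[x]).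
Proof.
move=> /andP[x0 x1].
have y0 : 0 < 1 - x by rewrite subr_gt0.
have dx := is_derive_powR b x0.
have dp := is_derive_horner p x.
have dy : is_derive x 1 (fun t : R => (1 - t) `^ a) (- (a * (1 - x) `^ (a - 1))).
  apply: (@is_derive_eq _ _ _ _ _ _ _ (a * (1 - x) `^ (a - 1) * (0 - 1))).
    exact: (@is_derive1_comp _ (fun t => t `^ a) (fun t => 1 - t) x _ _
      (is_derive_powR a y0)).
  by rewrite sub0r mulrN1.
have powRS (c z : R) : 0 < z -> z `^ c = z * z `^ (c - 1).
  move=> z0; rewrite -[X in X * _]powRr1 ?ltW// -powRD ?subrKC//.
  by rewrite (gt_eqF z0) implybT.
rewrite /jacw; apply: is_derive_eq.
rewrite !hornerE /GRing.scale/= (powRS b x)// (powRS a (1 - x))//.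
by ring.
Qed.

Lemma derive1n_jacw_horner (R : realType) (a b : R) (p : {poly R}) (k : nat) :
  exists q : {poly R}, forall x, 0 < x < 1 ->
    derive1n k (fun t => jacw a b t * p.[t]) x
      = jacw (a - k%:R) (b - k%:R) x * q.[x].
Proof.
elim: k => [|k [q IH]]; first by exists p => x _; rewrite !subr0.
eexists => x x01; rewrite derive1nS derive1E.
(* The induction hypothesis describes the k-th derivative on ]0, 1[ only, which suffices because
   derivation is local. *)
rewrite (near_eq_derive _ (g := fun t => jacw (a - k%:R) (b - k%:R) t * q.[t])).
  have [_ ->] := is_derive_jacw_horner (a - k%:R) (b - k%:R) q x01.
  by rewrite -!addrA -!opprD -natr1.
case/andP: x01 => x0 x1; near=> t; apply: IH.
by apply/andP; split; near: t; [exact: lt_nbhsr|exact: lt_nbhsl].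
Unshelve. all: by end_near. Qed.

Lemma jacw_sym (R : realType) (a b t : R) : jacw a b (1 - t) = jacw b a t.
Proof. by rewrite /jacw subKr mulrC. Qed.

(** The factor [t^b] tends to 0 and the others stay bounded near 0. The endpoint 1 reduces to this
    case through [jacw_sym]. *)
Lemma jacw_horner_cvg0 (R : realType) (a b : R) (p : {poly R}) : 0 < b ->
  jacw a b t * p.[t] @[t --> 0^'+] --> (0 : R).
Proof.
move=> b0.
rewrite -[X in _ --> X](mul0r p.[0]); apply: cvgM; last first.
  apply: (@cvg_at_right_filter _ _ (horner p)).
  by apply: differentiable_continuous; apply/derivable1_diffP/derivable_horner.
rewrite -[X in _ --> X](mul0r ((1 - 0) `^ a)); apply: cvgM; first exact: powR_cvg0.
apply: (@cvg_at_right_filter _ _ (fun t : R => (1 - t) `^ a)).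
apply: (@continuous_comp _ _ _ (fun t : R => 1 - t) (fun t => t `^ a)).
  by apply: cvgB; [exact: cvg_cst|exact: cvg_id].
apply: differentiable_continuous; apply/derivable1_diffP.
by apply: derivable_powR; rewrite in_itv/= subr0 ltr01.
Qed.

(** * Functions on ]0, 1[ with a primitive vanishing at both endpoints *)

Section kernel_primitive.
Variable R : realType.

(** Nothing is asked of [f] at 0 and 1, where the kernel may be singular. The limit at 1 is written
    with [1 - t] so that both endpoints become limits along the same filter. *)
Definition null_primitive (f : R -> R) := exists H : R -> R,
  [/\ forall t : R, 0 < t < 1 -> is_derive t 1 H (f t),
      H t @[t --> 0^'+] --> (0 : R) & H (1 - t) @[t --> 0^'+] --> (0 : R)].

Lemma null_primitive0 : null_primitive (fun=> 0).
Proof.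
exists (cst 0); split; try exact: cvg_cst.
by move=> t _; apply: is_derive_cst.
Qed.

Lemma null_primitiveD f g : null_primitive f -> null_primitive g ->
  null_primitive (fun t => f t + g t).
Proof.
move=> [F [dF F0 F1]] [G [dG G0 G1]]; exists (F + G); split.
- by move=> t t01; have := dF t t01; have := dG t t01; move=> ? ?; apply: is_deriveD.
- by rewrite -[X in _ --> X](addr0 0); apply: cvgD.
- by rewrite -[X in _ --> X](addr0 0); apply: (@cvgD _ _ _ _ _ (fun t => F (1 - t)) (fun t => G (1 - t))).
Qed.

Lemma null_primitiveZ c f : null_primitive f -> null_primitive (fun t => c * f t).
Proof.
move=> [F [dF F0 F1]]; exists (fun t => c * F t); split.
- by move=> t t01; have dFt := dF t t01; exact: (@is_deriveZ _ _ _ F).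
- by rewrite -[X in _ --> X](mulr0 c); apply: cvgMl_tmp.
- by rewrite -[X in _ --> X](mulr0 c); apply: (@cvgMl_tmp _ _ _ _ (fun t => F (1 - t))).
Qed.

Lemma eq_null_primitive f g : (forall t : R, 0 < t < 1 -> f t = g t) ->
  null_primitive f -> null_primitive g.
Proof.
by move=> fg [F [dF F0 F1]]; exists F; split => // t t01; rewrite -fg//; exact: dF.
Qed.

End kernel_primitive.

(** * Primitives and continuity of the Jacobi kernel *)

Section kernel.
Variable R : realType.

Lemma jacobiP_horner (a b : R) (k : nat) :
  exists p : {poly R}, forall t, jacobiP a b k t = p.[t].
Proof.
exists (\sum_(s < k.+1) (genbinom (k%:R + a) s * genbinom (k%:R + b) (k - s)) *:
  (('X - 1%:P) ^+ (k - s) * 'X ^+ s)) => t.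
rewrite /jacobiP horner_sum; apply: eq_bigr => s _.
by rewrite hornerZ hornerM !horner_exp hornerXsubC hornerX -!mulrA.
Qed.

Lemma is_derive_derive1n_jacw_horner (a b : R) (p : {poly R}) (k : nat) (t : R) :
  0 < t < 1 ->
  is_derive t 1 (derive1n k (fun t => jacw a b t * p.[t]))
    (derive1n k.+1 (fun t => jacw a b t * p.[t]) t).
Proof.
move=> t01; have [q Gq] := derive1n_jacw_horner a b p k.
apply: DeriveDef; last by rewrite derive1nS derive1E.
apply: (@near_eq_derivable _ _ _ (fun t => jacw (a - k%:R) (b - k%:R) t * q.[t])).
  case/andP: (t01) => t0 t1; near=> s; rewrite Gq//.
  by apply/andP; split; near: s; [exact: lt_nbhsr|exact: lt_nbhsl].
exact: (@ex_derive _ _ _ _ _ _ _ (is_derive_jacw_horner _ _ q t01)).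
Unshelve. all: by end_near. Qed.

(* Integration by parts: [G_(k+1) Q = (G_k Q)' - G_k Q'], where [G_k] is the
   k-th derivative of [jacw a b * p]. *)
Lemma null_primitive_derive1n (a b : R) (p : {poly R}) (k : nat) (Q : {poly R}) :
  k%:R - 1 < a -> k%:R - 1 < b -> (size Q <= k)%N ->
  null_primitive
    (fun t => derive1n k (fun t => jacw a b t * p.[t]) t * Q.[t]).
Proof.
elim: k Q => [|k IH] Q ka kb.
  rewrite leqn0 size_poly_eq0 => /eqP ->.
  by apply: eq_null_primitive (@null_primitive0 R) => t _; rewrite horner0 mulr0.
move=> sQ; rewrite -natr1 addrK in ka kb.
have [q Gq] := derive1n_jacw_horner a b p k.
set G := derive1n k _ in Gq *.
(* Derivation lowers both the order of [G] and the size of [Q]; at order 0 the polynomial is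
   zero. *)
have IHQ : null_primitive (fun t => G t * (Q^`()).[t]).
  apply: IH; rewrite ?(lt_trans _ ka) ?(lt_trans _ kb) ?gtrBl//.
  have [->|Q0] := eqVneq Q 0; first by rewrite deriv0 size_poly0.
  by rewrite -ltnS (leq_trans (lt_size_deriv Q0)).
have dG t (t01 : 0 < t < 1) := is_derive_derive1n_jacw_horner a b p k t01.
have near0 : \forall t \near (0 : R)^'+, 0 < t < 1.
  near=> t; apply/andP; split; near: t; first exact: nbhs_right_gt.
  exact: nbhs_right_lt.
have GQ : null_primitive
    (fun t => derive1n k.+1 (fun t => jacw a b t * p.[t]) t * Q.[t] + G t * (Q^`()).[t]).
  exists (fun t => G t * Q.[t]); split.
  - move=> t t01; have dGt := dG t t01; have dQt := is_derive_horner Q t.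
    apply: is_derive_eq; rewrite /GRing.scale/=.
    by rewrite addrC mulrC.
  - apply: cvg_trans (jacw_horner_cvg0 (a - k%:R) (q * Q) (b := b - k%:R) _).
      apply: near_eq_cvg; near=> t; rewrite hornerM mulrA Gq//.
      by near: t.
    by rewrite subr_gt0.
  (* At the endpoint 1, the substitution of [1 - t] for [t] swaps the two exponents and composes the
     polynomial with [1 - 'X]. *)
  - apply: cvg_trans (jacw_horner_cvg0 (b - k%:R) ((q * Q) \Po (1 - 'X)) (b := a - k%:R) _).
      apply: near_eq_cvg; near=> t.
      have t01 : 0 < t < 1 by near: t.
      have X1t : (1 - 'X : {poly R}).[t] = 1 - t by rewrite !hornerE.
      rewrite horner_comp X1t hornerM mulrA Gq ?jacw_sym//.
      by move: t01; lra.
    by rewrite subr_gt0.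
apply: eq_null_primitive (null_primitiveD GQ (null_primitiveZ (-1) IHQ)) => t _.
by rewrite mulN1r addrK.
Unshelve. all: by end_near. Qed.

(** Each term is handled by [null_primitive_derive1n] and the sum by linearity. The shift of the
    exponents by [n] turns [-1 < mu] and [-1 < kappa] into the bounds [n - 1 < mu + n] and
    [n - 1 < kappa + n] required there. *)
Lemma jacobi_kernel_null_primitive (n N : nat) (mu kappa xi beta T : R)
    (Q : {poly R}) : -1 < mu -> -1 < kappa -> (size Q <= n)%N ->
  null_primitive (fun t => jacobi_kernel n N mu kappa xi beta T t * Q.[t]).
Proof.
move=> mu1 kappa1 sQ.
pose f i t := derive1n n (fun t => jacw (mu + n%:R) (kappa + n%:R) t
  * jacobiP (mu + n%:R) (kappa + n%:R) i t) t * Q.[t].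
have f0 i : null_primitive (f i).
  have [p pE] := jacobiP_horner (mu + n%:R) (kappa + n%:R) i.
  rewrite /f; under [fun t => jacw _ _ t * jacobiP _ _ _ t]eq_fun do rewrite pE.
  by apply: null_primitive_derive1n => //; lra.
pose c i := jacobiP (mu + n%:R) (kappa + n%:R) i xi /
  jacnorm2 (mu + n%:R) (kappa + n%:R) i.
apply: (@eq_null_primitive _ (fun t =>
    (-1) ^+ n / (beta * T) ^+ n * \sum_(i < (N - n).+1) c i * f i t)).
  move=> t _; rewrite /jacobi_kernel -[RHS]mulrA mulr_suml; congr (_ * _).
  by apply: eq_bigr => i _; rewrite mulrA.
apply: null_primitiveZ.
elim: (_.+1) => [|m IH].
  by apply: eq_null_primitive (@null_primitive0 R) => t _; rewrite big_ord0.
under eq_fun do rewrite big_ord_recr/=.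
by apply: null_primitiveD => //; apply: null_primitiveZ.
Qed.

Lemma jacobi_kernel_continuous (n N : nat) (mu kappa xi beta T t : R) :
  0 < t < 1 -> {for t, continuous (jacobi_kernel n N mu kappa xi beta T)}.
Proof.
move=> t01.
pose F i := derive1n n (fun t => jacw (mu + n%:R) (kappa + n%:R) t
  * jacobiP (mu + n%:R) (kappa + n%:R) i t).
have dF i : derivable (F i) t 1.
  have [p pE] := jacobiP_horner (mu + n%:R) (kappa + n%:R) i.
  have -> : F i = derive1n n (fun t =>
      jacw (mu + n%:R) (kappa + n%:R) t * p.[t]).
    by congr derive1n; apply/funext => s; rewrite pE.
  exact: (@ex_derive _ _ _ _ _ _ _ (is_derive_derive1n_jacw_horner _ _ p n t01)).
apply: differentiable_continuous; apply/derivable1_diffP.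
rewrite (_ : jacobi_kernel _ _ _ _ _ _ _ = ((-1) ^+ n / (beta * T) ^+ n) \*:
  (\sum_(i < (N - n).+1) ((jacobiP (mu + n%:R) (kappa + n%:R) i xi /
     jacnorm2 (mu + n%:R) (kappa + n%:R) i) \*: F i))); last first.
  by apply/funext => s; rewrite /= fct_sumE.
by apply: derivableZ; apply: derivable_sum => i; exact: derivableZ.
Qed.

End kernel.

(** * Convergence of Riemann sums of a derivative *)

(** Heine's theorem by the near-covering form of compactness: if [del] works at [x] for [eps / 2],
    then every radius below [del / 2] works for [eps] at every point within [del / 2] of [x]. *)
Lemma compact_unif_continuous (R : realType) (A : set R) (f : R -> R) :
  compact A -> (forall x, A x -> {for x, continuous f}) ->
  forall eps : R, 0 < eps -> exists2 delta : R, 0 < delta &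
    forall x y, A x -> A y -> `|x - y| < delta -> `|f x - f y| < eps.
Proof.
move=> /compact_near_coveringP cA cf eps eps0.
have : \forall del \near (0 : R)^'+,
    A `<=` [set x | forall y, `|x - y| < del -> `|f x - f y| < eps].
  apply: (cA R (0 : R)^'+
    (fun del x => forall y, `|x - y| < del -> `|f x - f y| < eps)) => x Ax.
  have e20 : 0 < eps / 2 by rewrite divr_gt0.
  have /cvgrPdist_lt /(_ _ e20) /nbhs_normP[del /= del0 hdel] := cf x Ax.
  exists (ball x (del / 2), [set t | t < del / 2]).
    split => /=; first by apply: nbhsx_ballx; rewrite divr_gt0.
    by apply: nbhs_right_lt; rewrite divr_gt0.
  move=> [x' r] /= [xx' rdel] y x'y.
  have h1 : `|f x - f x'| < eps / 2.
    by apply: hdel => /=; move: xx'; rewrite /ball/=; lra.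
  have h2 : `|f x - f y| < eps / 2.
    apply: hdel => /=; rewrite -(subrK x' x) -addrA.
    apply: le_lt_trans (ler_normD _ _) _.
    by move: xx' rdel x'y; rewrite /ball/=; lra.
  rewrite -(subrK (f x) (f x')) -addrA.
  apply: le_lt_trans (ler_normD _ _) _.
  by rewrite distrC; lra.
move=> near_del; near (0 : R)^'+ => del.
exists del; first by near: del; exact: nbhs_right_gt.
by move=> x y Ax _; apply: (near near_del del _ x Ax y) => //.
Unshelve. all: by end_near. Qed.

Lemma tagged_partition_bounds (R : realType) (a b : R) m x y : tagged_partition a b m x y ->
  forall i, (i < m)%N -> [/\ a <= x i, x i <= y i, y i <= x i.+1 & x i.+1 <= b].
Proof.
move=> [<- [<- h]].
have mono i j : (i <= j <= m)%N -> x i <= x j.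
  move=> /andP[]; elim: j => [|j IH]; first by rewrite leqn0 => /eqP ->.
  rewrite leq_eqVlt => /predU1P[->//|ij jm].
  apply: (le_trans (IH ij (ltnW jm))).
  by have /andP[/le_trans] := h _ jm; apply.
move=> i im; have /andP[h1 h2] := h i im; split => //; apply: mono => //.
  by rewrite leq0n ltnW.
by rewrite im leqnn.
Qed.

(** On each cell the mean value theorem writes the increment of [H] as [h c] times the length, and
    uniform continuity bounds [h (y i) - h c]. *)
Lemma riemann_sum_derive_cvg (R : realType) (a b : R) (h H : R -> R) : a < b ->
  (forall t, t \in `[a, b] -> {for t, continuous h}) ->
  (forall t, t \in `[a, b] -> is_derive t 1 H (h t)) ->
  forall eps : R, 0 < eps -> exists2 delta : R, 0 < delta &
    forall m x y, tagged_partition a b m x y -> mesh_lt m x delta ->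
      `| \sum_(i < m) h (y i) * (x i.+1 - x i) - (H b - H a) | < eps.
Proof.
move=> ab ch dH eps eps0.
have ba0 : 0 < b - a by rewrite subr_gt0.
(* With the tolerance [eps / (2 * (b - a))] the cell errors add up to at most [eps / 2], hence
   strictly less than [eps]. *)
have [del del0 hdel] := compact_unif_continuous (@segment_compact _ a b) ch
  (divr_gt0 eps0 (mulr_gt0 (ltr0n _ 2) ba0)).
exists del => // m x y xy mesh.
have bnd := tagged_partition_bounds xy.
(* Stated for any [g]: it is used with [H], and with the identity to sum the cell lengths. *)
have tel (g : R -> R) : g b - g a = \sum_(i < m) (g (x i.+1) - g (x i)).
  case: xy => <- [<- _].
  by rewrite -(big_mkord xpredT (fun i => g (x i.+1) - g (x i))) telescope_sumr.
rewrite tel -sumrB.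
have : `|\sum_(i < m) (h (y i) * (x i.+1 - x i) - (H (x i.+1) - H (x i)))|
   <= \sum_(i < m) eps / (2 * (b - a)) * (x i.+1 - x i).
  apply: le_trans (ler_norm_sum _ _ _) _; apply: ler_sum => i _.
  have [ax xy1 yx xb] := bnd i (ltn_ord i).
  have xx := le_trans xy1 yx.
  have sub t : t \in `[x i, x i.+1] -> t \in `[a, b].
    by rewrite !in_itv/= => /andP[/(le_trans ax) -> /le_trans ->].
  have [c cx ->] := MVT_segment xx
    (fun t tx => dH t (sub t (subset_itv_oo_cc tx)))
    (derivable_within_continuous (fun t tx => @ex_derive _ _ _ _ _ _ _ (dH t (sub t tx)))).
  rewrite -mulrBl normrM [X in _ * X]ger0_norm ?subr_ge0//.
  apply: ler_wpM2r; first by rewrite subr_ge0.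
  have yI : y i \in `[x i, x i.+1] by rewrite in_itv/= xy1.
  apply/ltW/hdel; [exact: sub|exact: sub|].
  move: cx; rewrite in_itv/= => /andP[c1 c2].
  apply: le_lt_trans (mesh i (ltn_ord i)).
  by rewrite ler_norml; lra.
move/le_lt_trans; apply.
rewrite -mulr_sumr -(tel id) invfM mulrA mulfVK ?gt_eqF//; lra.
Qed.

(** * Square-integrable variables and processes with rank-one covariance *)

Section mean_square.
Context d (Omega : measurableType d) (R : realType) (P : probability Omega R).
Implicit Types X Y Z : Omega -> R.

Lemma Lfun_measurable X : X \in Lfun P 2%:E -> measurable_fun setT X.
Proof. by rewrite inE => /andP[]; rewrite inE. Qed.

Let measurable_sqr X : measurable_fun setT X ->
  measurable_fun setT (EFin \o (fun w => X w ^+ 2)).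
Proof. by move=> mX; apply/measurable_EFinP; exact: measurable_funX. Qed.

Lemma Lfun2B X Y : X \in Lfun P 2%:E -> Y \in Lfun P 2%:E ->
  X \- Y \in Lfun P 2%:E.
Proof. by move=> X2 Y2; rewrite rpredB ?lee1n. Qed.

Lemma integral_sqrD_le X Y : measurable_fun setT X -> measurable_fun setT Y ->
  (\int[P]_w ((X w + Y w) ^+ 2)%:E <=
   2%:E * (\int[P]_w (X w ^+ 2)%:E) + 2%:E * (\int[P]_w (Y w ^+ 2)%:E))%E.
Proof.
move=> mX mY.
have mX2 := measurable_sqr mX; have mY2 := measurable_sqr mY.
have sqr_ge0E (Z : Omega -> R) w : (0 <= (Z w ^+ 2)%:E)%E by rewrite lee_fin sqr_ge0.
rewrite -!ge0_integralZl// -ge0_integralD//; last 4 first.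
- by move=> w _; rewrite mule_ge0// sqr_ge0E.
- exact: measurable_funeM.
- by move=> w _; rewrite mule_ge0// sqr_ge0E.
- exact: measurable_funeM.
apply: ge0_le_integral => //.
- by move=> w _; exact: (sqr_ge0E (X \+ Y)).
- by apply: (@measurable_sqr (X \+ Y)); exact: measurable_funD.
- by apply: emeasurable_funD; exact: measurable_funeM.
- by move=> w _; rewrite -!EFinM -EFinD lee_fin; have := sqr_ge0 (X w - Y w); lra.
Qed.

(** Reduces mean-square smallness of [u + v Z] to smallness of the two real coefficients. *)
Lemma integral_sqr_affine_le (u v : R) Z : Z \in Lfun P 2%:E ->
  (\int[P]_w ((u + v * Z w) ^+ 2)%:E <=
   (2 * u ^+ 2 + 2 * (v ^+ 2 * fine (\int[P]_w (Z w ^+ 2)%:E)))%:E)%E.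
Proof.
move=> Z2; have mZ := Lfun_measurable Z2.
apply: le_trans (integral_sqrD_le (measurable_cst u)
  (measurable_funM (measurable_cst v) mZ)) _.
have -> : (\int[P]_w (cst u w ^+ 2)%:E = (u ^+ 2)%:E)%E.
  transitivity ((u ^+ 2)%:E * P [set: Omega])%E; last first.
    by rewrite [P _]probability_setT mule1.
  exact: (integral_cst P measurableT (u ^+ 2)%:E).
have fZ2 : (\int[P]_w (Z w ^+ 2)%:E)%E \is a fin_num.
  by rewrite integrable_fin_num//; exact: Lfun2_integrable_sqr.
have -> : (\int[P]_w ((cst v \* Z) w ^+ 2)%:E =
    (v ^+ 2)%:E * \int[P]_w (Z w ^+ 2)%:E)%E.
  rewrite -ge0_integralZl//.
  - by apply: eq_integral => w _; rewrite -EFinM -exprMn.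
  - exact: measurable_sqr.
  - by move=> w _; rewrite lee_fin sqr_ge0.
  - by rewrite lee_fin sqr_ge0.
by rewrite -[X in (_ * (_ * X))%E](fineK fZ2) -!EFinM -EFinD.
Qed.

Lemma ae0_integral_sqr X : measurable_fun setT X ->
  (forall eps : R, 0 < eps -> (\int[P]_w (X w ^+ 2)%:E <= eps%:E)%E) ->
  {ae P, forall w, X w = 0}.
Proof.
move=> mX small.
have X0 : (\int[P]_w `|(X w ^+ 2)%:E| = 0)%E.
  under eq_integral do rewrite gee0_abs ?lee_fin ?sqr_ge0//.
  apply/eqP; rewrite eq_le integral_ge0 ?andbT; last first.
    by move=> w _; rewrite lee_fin sqr_ge0.
  by apply/lee_addgt0Pr => eps eps0; rewrite add0e small.
have /(ae_eq_integral_abs P measurableT (measurable_sqr mX)) := X0.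
by apply: filterS => w /(_ I)/= [] /eqP; rewrite sqrf_eq0 => /eqP.
Qed.

Lemma ae_cst_variance0 X : X \in Lfun P 2%:E -> variance P X = 0%E ->
  {ae P, forall w, X w = fine ('E_P[X])%E}.
Proof.
move=> X2; rewrite /variance unlock; set c := fine _ => V0.
have mX := Lfun_measurable X2.
suff : {ae P, forall w, X w - c = 0}.
  by apply: filterS => w /eqP; rewrite subr_eq0 => /eqP.
apply: ae0_integral_sqr; first exact: measurable_funB.
move=> eps eps0; move: V0; rewrite unlock.
under eq_integral do rewrite !fctE -expr2.
by move=> ->; rewrite lee_fin ltW.
Qed.

(** If [X s0] has nonzero variance, subtracting the right multiple of [X s0] from [X t] leaves a
    variable of variance zero, hence almost surely constant. The equality [ca * a t = cb * b t] lets
    the caller use either covariance factor. *)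
Lemma rank_one_process (A : set R) (X : R -> Omega -> R) (m a b : R -> R) :
  (forall t, A t -> X t \in Lfun P 2%:E) ->
  (forall t, A t -> 'E_P[X t] = (m t)%:E)%E ->
  (forall s t, A s -> A t -> covariance P (X s) (X t) = (a t * b s)%:E) ->
  exists (Z : Omega -> R) (ca cb : R), Z \in Lfun P 2%:E /\
    forall t, A t -> ca * a t = cb * b t /\
      {ae P, forall w, X t w = m t + ca * a t * Z w}.
Proof.
move=> X2 Xm Xab.
have [[s0 [As0 ab0]]|] := pselect (exists s, A s /\ a s * b s != 0); last first.
  (* All variances on [A] vanish, so each [X t] is almost surely its mean. *)
  move=> noA; exists (cst 0), 0, 0; split; first exact: Lfun_cst.
  move=> t At; split; first by rewrite !mul0r.
  have abt0 : a t * b t = 0.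
    by apply: contrapT => abt; apply: noA; exists t; split => //; apply/eqP.
  have := ae_cst_variance0 (X2 t At).
  rewrite /variance Xab// abt0 => /(_ erefl).
  by apply: filterS => w ->; rewrite Xm//= !mul0r addr0.
have [a0 b0] : a s0 != 0 /\ b s0 != 0.
  by move: ab0; rewrite mulf_eq0 negb_or => /andP[].
have Esym t : A t -> a t * b s0 = a s0 * b t.
  by move=> At; apply: EFin_inj; rewrite -Xab// covarianceC Xab.
exists (X s0 \- cst (m s0)), (a s0)^-1, (b s0)^-1; split.
  by apply: Lfun2B; [exact: X2|exact: Lfun_cst].
move=> t At.
have eqab : (a s0)^-1 * a t = (b s0)^-1 * b t.
  by apply/eqP; rewrite ![_^-1 * _]mulrC eqr_div// Esym// mulrC.
split => //; set phi := _ * a t.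
pose U := X t \- (phi \o* X s0).
have L1 Y : Y \in Lfun P 2%:E -> Y \in Lfun P 1.
  by apply: Lfun_subset12; rewrite fin_num_measure.
have phiX2 : phi \o* X s0 \in Lfun P 2%:E by apply: Lfun_scale; rewrite ?ler1n ?X2.
have U2 : U \in Lfun P 2%:E by apply: Lfun2B => //; exact: X2.
have EU : ('E_P[U] = (m t - phi * m s0)%:E)%E.
  rewrite expectationB ?L1 ?X2// expectationZl ?L1 ?X2//.
  by rewrite !Xm// -EFinM -EFinB.
have VU : variance P U = 0%E.
  have Xt2 := X2 t At; have Xs2 := X2 s0 As0.
  rewrite (varianceB Xt2 phiX2) (varianceZ _ Xs2).
  rewrite (covarianceZr _ (L1 _ Xt2) (L1 _ Xs2) (Lfun2_mul_Lfun1 Xt2 Xs2)).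
  (* Since [a t = phi * a s0] and [b t = phi * b s0], the variance is [phi^2 * a s0 * b s0] times
     [1 + 1 - 2]. *)
  rewrite /variance !Xab// -!EFinM -EFinD; congr EFin.
  have -> : b t = phi * b s0 by rewrite /phi eqab mulrC mulrA mulfV// mul1r.
  have -> : a t = phi * a s0 by rewrite /phi mulrAC mulVf// mul1r.
  by ring.
have := ae_cst_variance0 U2 VU; rewrite EU; apply: filterS => w /=.
by rewrite /U /= => Uw; lra.
Qed.

(** For a fixed partition the error is almost surely [u + v Z], where [u] and [v] are the errors of
    two deterministic Riemann sums. *)
Lemma ms_integral_rank_one (g m phi Hm Hphi : R -> R) (X : R -> Omega -> R) Z
    (a b : R) : a < b ->
  (forall t, measurable_fun setT (X t)) -> Z \in Lfun P 2%:E ->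
  (forall t, a <= t <= b -> {ae P, forall w, X t w = m t + phi t * Z w}) ->
  (forall t, a <= t <= b -> {for t, continuous (fun t => g t * m t)}) ->
  (forall t, a <= t <= b -> {for t, continuous (fun t => g t * phi t)}) ->
  (forall t, a <= t <= b -> is_derive t 1 Hm (g t * m t)) ->
  (forall t, a <= t <= b -> is_derive t 1 Hphi (g t * phi t)) ->
  ms_integral P g X a b
    (fun w => (Hm b - Hm a) + (Hphi b - Hphi a) * Z w).
Proof.
move=> ab mX Z2 XE cm cphi dm dphi eps eps0.
have mZ := Lfun_measurable Z2.
pose V := fine (\int[P]_w (Z w ^+ 2)%:E).
have V0 : 0 <= V by rewrite fine_ge0// integral_ge0// => w _; rewrite lee_fin sqr_ge0.
(* Chosen so that [2 * eta^2 + 2 * eta^2 * V] equals [eps / 2]; the [1 +] keeps the denominator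
   nonzero when [V = 0]. *)
pose eta := Num.sqrt (eps / (4 * (1 + V))).
have eta0 : 0 < eta by rewrite sqrtr_gt0 divr_gt0// mulr_gt0// ltr_wpDr.
have eta2 : eta ^+ 2 = eps / (4 * (1 + V)).
  by rewrite sqr_sqrtr// divr_ge0 ?ltW// mulr_gt0// ltr_wpDr.
have [d1 d10 hd1] := riemann_sum_derive_cvg ab cm dm eta0.
have [d2 d20 hd2] := riemann_sum_derive_cvg ab cphi dphi eta0.
exists (Num.min d1 d2); first by rewrite lt_min d10.
move=> k x y xy mesh.
pose u := \sum_(i < k) g (y i) * m (y i) * (x i.+1 - x i) - (Hm b - Hm a).
pose v := \sum_(i < k) g (y i) * phi (y i) * (x i.+1 - x i) - (Hphi b - Hphi a).
have u2 : u ^+ 2 < eta ^+ 2.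
  rewrite -(real_normK (num_real u)) ltrXn2r// ?nnegrE ?ltW//.
  by apply: hd1 xy _ => i ik; apply: lt_le_trans (mesh i ik) _; rewrite ge_min lexx.
have v2 : v ^+ 2 < eta ^+ 2.
  rewrite -(real_normK (num_real v)) ltrXn2r// ?nnegrE ?ltW//.
  by apply: hd2 xy _ => i ik; apply: lt_le_trans (mesh i ik) _; rewrite ge_min lexx orbT.
have mS : measurable_fun setT (riemann_sum g X k x y).
  apply: measurable_sum => i; apply: measurable_funM => //.
  exact: measurable_funM.
have -> : (\int[P]_w ((riemann_sum g X k x y w -
    (Hm b - Hm a + (Hphi b - Hphi a) * Z w)) ^+ 2)%:E =
    \int[P]_w ((u + v * Z w) ^+ 2)%:E)%E.
  apply: ge0_ae_eq_integral => //.
  - apply: (@measurable_sqr (riemann_sum g X k x y \-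
      (fun w => Hm b - Hm a + (Hphi b - Hphi a) * Z w))).
    apply: measurable_funB => //; apply: measurable_funD => //.
    exact: measurable_funM.
  - apply: (@measurable_sqr (fun w => u + v * Z w)).
    by apply: measurable_funD => //; exact: measurable_funM.
  - by move=> w _; rewrite lee_fin sqr_ge0.
  - by move=> w _; rewrite lee_fin sqr_ge0.
  (* The exceptional null set depends on the time, but a partition has finitely many tags. *)
  have : {ae P, forall w (i : 'I_k), X (y i) w = m (y i) + phi (y i) * Z w}.
    apply: filter_forall => i; apply: XE.
    have [ax xy1 yx xb] := tagged_partition_bounds xy (ltn_ord i).
    by rewrite (le_trans ax xy1) (le_trans yx xb).
  apply: filterS => w Xw _; congr (_ ^+ 2)%:E.
  have -> : riemann_sum g X k x y w =
      \sum_(i < k) g (y i) * m (y i) * (x i.+1 - x i) +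
      (\sum_(i < k) g (y i) * phi (y i) * (x i.+1 - x i)) * Z w.
    rewrite /riemann_sum mulr_suml -big_split; apply: eq_bigr => i _ /=.
    by rewrite Xw; ring.
  by rewrite /u /v; ring.
apply: le_lt_trans (integral_sqr_affine_le u v Z2) _.
rewrite lte_fin -/V.
have -> : eps = 4 * (1 + V) * eta ^+ 2.
  by rewrite eta2 mulrC divfK// mulf_neq0// gt_eqF// ltr_wpDr.
have : v ^+ 2 * V <= eta ^+ 2 * V by rewrite ler_wpM2r// ltW.
have : 0 <= V * eta ^+ 2 by rewrite mulr_ge0// sqr_ge0.
nra.
Qed.

End mean_square.

(** * Vanishing of the improper mean-square integral *)

Section vanishing.
Context d (Omega : measurableType d) (R : realType) (P : probability Omega R).

Lemma ms_integral01_rank_one_eq0 (g m phi : R -> R) (X : R -> Omega -> R)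
    (Z e : Omega -> R) :
  (forall t, measurable_fun setT (X t)) -> measurable_fun setT e ->
  Z \in Lfun P 2%:E ->
  (forall t, 0 < t < 1 -> {ae P, forall w, X t w = m t + phi t * Z w}) ->
  (forall t, 0 < t < 1 -> {for t, continuous (fun t => g t * m t)}) ->
  (forall t, 0 < t < 1 -> {for t, continuous (fun t => g t * phi t)}) ->
  null_primitive (fun t => g t * m t) ->
  null_primitive (fun t => g t * phi t) ->
  ms_integral01 P g X e -> {ae P, forall w, e w = 0}.
Proof.
(* The integrals over [a, b] provided by [ms_integral01] may be non-measurable
   functions, for which the integral of the square is not subadditive; the
   limit is therefore tested on the explicit integral [er] below. *)
move=> mX me Z2 XE cm cphi [Hm [dm m0 m1]] [Hphi [dphi phi0 phi1]] [_ lim_e].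
have mZ := Lfun_measurable Z2.
pose V := fine (\int[P]_w (Z w ^+ 2)%:E).
(* Coefficients of the integral over the symmetric interval [[r, 1 - r]], so that a single parameter
   drives both endpoints. *)
pose u r := Hm (1 - r) - Hm r; pose v r := Hphi (1 - r) - Hphi r.
have bnd0 : 2 * u r ^+ 2 + 2 * (v r ^+ 2 * V) @[r --> 0^'+] --> (0 : R).
  have u0 : u r @[r --> 0^'+] --> (0 : R).
    by rewrite -[X in _ --> X](subr0 0); apply: cvgB.
  have v0 : v r @[r --> 0^'+] --> (0 : R).
    by rewrite -[X in _ --> X](subr0 0); apply: cvgB.
  rewrite [X in _ --> X](_ : 0 = 2 * 0 ^+ 2 + 2 * (0 ^+ 2 * V)); last by ring.
  apply: cvgD; apply: cvgMl_tmp; first exact: (cvgM u0 u0).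
  by apply: cvgMr_tmp; exact: (cvgM v0 v0).
apply: (ae0_integral_sqr me) => eps eps0.
(* [e] is split as [(e - er) + er]; each part has second moment at most [eps / 4], and
   [integral_sqrD_le] doubles both. *)
have eps4 : 0 < eps / 4 by rewrite divr_gt0.
have [del del0 hdel] := lim_e _ eps4.
near (0 : R)^'+ => r.
have r0 : 0 < r by near: r; exact: nbhs_right_gt.
have r2 : r < 1 / 2 by near: r; apply: nbhs_right_lt; rewrite divr_gt0.
have rdel : r < del by near: r; exact: nbhs_right_lt.
have bndr : 2 * u r ^+ 2 + 2 * (v r ^+ 2 * V) < eps / 4.
  by near: r; exact: cvgr_lt eps4.
have rr : r < 1 - r by lra.
pose er w := u r + v r * Z w.
have in01 t : r <= t <= 1 - r -> 0 < t < 1 by move=> /andP[? ?]; apply/andP; split; lra.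
have int_er : ms_integral P g X r (1 - r) er.
  by apply: (ms_integral_rank_one rr mX Z2) => t /in01; auto.
have r1 : 1 - r < 1 by lra.
have rdel1 : 1 - del < 1 - r by lra.
have er_e := hdel _ _ _ r0 rdel rdel1 r1 rr int_er.
have mer : measurable_fun setT er.
  by apply: measurable_funD => //; exact: measurable_funM.
have -> : (\int[P]_w (e w ^+ 2)%:E = \int[P]_w (((e w - er w) + er w) ^+ 2)%:E)%E.
  by apply: eq_integral => w _; rewrite subrK.
apply: le_trans (integral_sqrD_le P (measurable_funB me mer) mer) _.
have -> : (\int[P]_w ((e \- er) w ^+ 2)%:E = \int[P]_w ((er w - e w) ^+ 2)%:E)%E.
  by apply: eq_integral => w _; rewrite /= -sqrrN opprB.
have er2 : (\int[P]_w (er w ^+ 2)%:E <= (eps / 4)%:E)%E.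
  apply: le_trans (integral_sqr_affine_le (u r) (v r) Z2) _.
  by rewrite lee_fin ltW.
have -> : eps%:E = (2%:E * (eps / 4)%:E + 2%:E * (eps / 4)%:E)%E.
  by rewrite -!EFinM -EFinD; congr EFin; field.
by apply: leeD; rewrite lee_pmul2l// ltW.
Unshelve. all: by end_near. Qed.

End vanishing.

(** * Affine change of time and conclusion *)

(** Keeps the degree below [n] when polynomials in the time [t0 + beta * T * t] are rewritten in the
    kernel variable [t]. *)
Lemma size_comp_poly_affine (R : idomainType) (p : {poly R}) (c k : R) :
  (size (p \Po (c%:P + k *: 'X)) <= size p)%N.
Proof.
have [->|p0] := eqVneq p 0; first by rewrite comp_poly0.
apply: leq_trans (size_comp_poly_leq _ _) _.
have sq : (size (c%:P + k *: 'X)%R <= 2)%N.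
  apply: leq_trans (size_polyD _ _) _; rewrite geq_max.
  rewrite (leq_trans (size_polyC_leq1 _))//.
  by rewrite (leq_trans (size_scale_leq _ _))// size_polyX.
rewrite -[leqRHS]prednK ?size_poly_gt0// ltnS -[leqRHS]muln1 leq_mul2l.
by case: (size _) sq => [|[|[]]] //=; rewrite orbT.
Qed.

Unset Implicit Arguments.

Theorem theorem2 (d : measure_display) (Omega : measurableType d) (R : realType)
  (P : probability Omega R)
  (I : set R) (lI rI : \bar R)
  (n N : nat) (beta kappa mu xi t0 T : R)
  (varpi : R -> {RV P >-> R}) (e : {RV P >-> R}) :
  (* I is an open interval contained in [0, +oo) *)
  (0 <= lI)%E -> I = [set t | (lI < t%:E < rI)%E] ->
  (beta = -1 \/ beta = 1) -> -1 < kappa -> -1 < mu ->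
  (n <= N)%N -> 0 <= xi <= 1 -> t0 \in I -> 0 < T -> (t0 + beta * T) \in I ->
  (* (C1) *)
  (forall tau, 0 <= tau -> (varpi tau : Omega -> R) \in Lfun P 2%:E) ->
  {within `[0, +oo[, continuous (fun tau => fine ('E_P[varpi tau])%E)} ->
  {within [set st : R * R | 0 <= st.1 /\ 0 <= st.2],
    continuous (fun st : R * R => fine (covariance P (varpi st.1) (varpi st.2)))} ->
  (* (C2) *)
  (exists (nu eta eta' : nat -> R) (k1 k2 k3 : nat -> nat) (n1 n2 : nat),
     (minn n1 n2 < n)%N /\
     forall t s tau : R, (t + s) \in I -> (t + tau) \in I ->
       ('E_P[varpi (t + tau)%R])%E =
          ((\sum_(i < n) nu i * t ^+ k1 i * tau ^+ i)%:E + 'E_P[varpi tau])%E /\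
       covariance P (varpi (t + s)%R) (varpi (t + tau)%R) =
          (((\sum_(i < n1.+1) eta i * t ^+ k2 i * tau ^+ i) *
            (\sum_(i < n2.+1) eta' i * t ^+ k3 i * s ^+ i))%:E
           + covariance P (varpi s) (varpi tau))%E) ->
  (* (C3) *)
  (exists (nub etab etab' : nat -> R) (n1 n2 : nat),
     (minn n1 n2 < n)%N /\
     forall s tau : R, s \in I -> tau \in I ->
       ('E_P[varpi tau])%E = (\sum_(i < n) nub i * tau ^+ i)%:E /\
       covariance P (varpi s) (varpi tau) =
          ((\sum_(i < n1.+1) etab i * tau ^+ i) *
           (\sum_(i < n2.+1) etab' i * s ^+ i))%:E) ->
  (* e is the noise error contribution e_varpi^{beta T}(t0) *)
  ms_integral01 P (jacobi_kernel n N mu kappa xi beta T)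
    (fun tau => (varpi (t0 + beta * T * tau) : Omega -> R)) e ->
  {ae P, forall w, e w = 0}.
Proof.
move=> lI0 -> _ kappa1 mu1 _ _ /set_mem/= t0I _ /set_mem/= t1I X2 _ _ _
  [nub [etab [etab' [n1 [n2 [n12 C3]]]]]] int_e.
set A := [set t | _] in C3.
have X2A t : A t -> (varpi t : Omega -> R) \in Lfun P 2%:E.
  by move=> /andP[lt _]; apply: X2; rewrite -lee_fin (le_trans lI0)// ltW.
have pE (c : nat -> R) k t : \sum_(i < k) c i * t ^+ i = (\poly_(i < k) c i).[t].
  by rewrite horner_poly.
have [Z [ca [cb [Z2 XZ]]]] := @rank_one_process _ _ _ P A
  (fun t => varpi t : Omega -> R) (horner (\poly_(i < n) nub i))
  (horner (\poly_(i < n1.+1) etab i)) (horner (\poly_(i < n2.+1) etab' i)) X2A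
  (fun t At => etrans (proj1 (C3 t t (mem_set At) (mem_set At)))
    (congr1 EFin (pE nub n t)))
  (fun s t As At => etrans (proj2 (C3 s t (mem_set As) (mem_set At)))
    (congr1 EFin (congr2 *%R (pE etab n1.+1 t) (pE etab' n2.+1 s)))).
have [phi sphi phiE] : exists2 phi : {poly R}, (size phi <= n)%N &
    forall t, A t -> {ae P, forall w, varpi t w = (\poly_(i < n) nub i).[t] + phi.[t] * Z w}.
  move: n12; rewrite gtn_min => /orP[n1n|n2n].
  - exists (ca *: \poly_(i < n1.+1) etab i).
      by rewrite (leq_trans (size_scale_leq _ _))// (leq_trans (size_poly _ _)).
    by move=> t /XZ[_]; rewrite hornerZ.
  - exists (cb *: \poly_(i < n2.+1) etab' i).
      by rewrite (leq_trans (size_scale_leq _ _))// (leq_trans (size_poly _ _)).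
    by move=> t /XZ[->]; rewrite hornerZ.
pose L : {poly R} := t0%:P + (beta * T) *: 'X.
have LE t : L.[t] = t0 + beta * T * t by rewrite hornerD hornerC hornerZ hornerX.
(* The point lies between [t0] and [t0 + beta * T], both in the interval; the sign of [beta * T]
   tells which of them is the left one. *)
have AL t : 0 < t < 1 -> A (t0 + beta * T * t).
  move=> /andP[tgt0 tlt1]; rewrite /A/=; move: t0I t1I => /andP[l0 r0] /andP[l1 r1].
  have [bT|bT] := leP 0 (beta * T); apply/andP; split.
  - by apply: lt_le_trans l0 _; rewrite lee_fin; nra.
  - by apply: le_lt_trans r1; rewrite lee_fin; nra.
  - by apply: lt_le_trans l1 _; rewrite lee_fin; nra.
  - by apply: le_lt_trans r0; rewrite lee_fin; nra.
pose g := jacobi_kernel n N mu kappa xi beta T.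
have cont (Q : {poly R}) t : 0 < t < 1 -> {for t, continuous (fun t => g t * Q.[t])}.
  move=> t01; apply: continuousM; first exact: jacobi_kernel_continuous.
  by apply: differentiable_continuous; apply/derivable1_diffP/derivable_horner.
have prim (Q : {poly R}) : (size Q <= n)%N -> null_primitive (fun t => g t * (Q \Po L).[t]).
  move=> sQ; apply: jacobi_kernel_null_primitive => //.
  by rewrite (leq_trans (size_comp_poly_affine _ _ _)).
apply: (@ms_integral01_rank_one_eq0 _ _ _ P g (horner (\poly_(i < n) nub i \Po L))
  (horner (phi \Po L)) _ Z) int_e => //.
- by move=> t t01; rewrite !horner_comp LE; apply/phiE/AL.
- exact: cont.
- exact: cont.
- by apply: prim; exact: size_poly.
- exact: prim.
Qed.
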